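(* Let $P\in\mathcal{P}$. Then the function $$t\mapsto\frac{1}{\mathcal{C}(P(t))},\qquad t\in[\xi_\ell,\xi_r],$$ is a convex quadratic polynomial in $t$.
   Context: For a convex body $K\subset\mathbb{R}^2$ (compact convex set with nonempty interior), $|K|$ is its area, $\mathrm{Cov}(K)$ is the $2\times2$ matrix $\mathrm{Cov}(K)_{ij}=\int_K u_iu_j\frac{du}{|K|}-\int_K u_i\frac{du}{|K|}\int_K u_j\frac{du}{|K|}$, and $\mathcal{C}(K)=|K|^2/\det\mathrm{Cov}(K)$. The class $\mathcal{P}$: it consists of the convex polygons $P=\mathrm{co}\{(x_1,y_1),\dots,(x_m,y_m)\}\subset\mathbb{R}^2$ ($\mathrm{co}$ = convex hull), $m>3$, together with the labelling, such that the $(x_i,y_i)$ are the (distinct) extreme points of $P$ listed counter-clockwise, $x_3\le x_2\le x_1$, $0\le y_1=y_3<y_2$, and $0\in\mathrm{int}\,\widehat P$, where $\widehat P=\mathrm{co}\{(x_1,y_1),(x_3,y_3),\dots,(x_m,y_m)\}$ omits the vertex $(x_2,y_2)$. Mahler sliding: $P(t)=\mathrm{co}\{(x_1,y_1),(t,y_2),(x_3,y_3),\dots,(x_m,y_m)\}$ is obtained by replacing the first coordinate of the second vertex by $t$, all else fixed (so $P=P(x_2)$). The numbers $\xi_\ell<\xi_r$ are defined by: $(x_3,y_3)$ lies on the segment from $(\xi_\ell,y_2)$ to $(x_4,y_4)$, and $(x_1,y_1)$ lies on the segment from $(\xi_r,y_2)$ to $(x_m,y_m)$. *)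

(* Defs.v *)
From HB Require Import structures.
From mathcomp Require Import all_boot all_order all_algebra.
From mathcomp Require Import all_classical all_reals all_analysis.
Import Order.TTheory GRing.Theory Num.Theory numFieldNormedType.Exports.

Set Implicit Arguments.
Unset Strict Implicit.
Unset Printing Implicit Defensive.

Local Open Scope classical_set_scope.
Local Open Scope ring_scope.
Local Open Scope convex_scope.

(* Points of the plane have type R * R, which carries the product topology and
   the product Lebesgue measure; its R-module structure, used by convex_set
   and by the barycenters a <| t |> b, is that of R^o * R^o. *)
Definition conv2 (R : realType) (t : {i01 R}) (a b : R * R) : R * R :=
  (a : convex_lmodType (R^o * R^o)%type) <| t |> b.

Definition convex2 (R : realType) (A : set (R * R)) : Prop :=
  @convex_set R (R^o * R^o)%type A.

Definition co (R : realType) (A : set (R * R)) : set (R * R) :=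
  smallest (@convex2 R) A.

Definition segment (R : realType) (a b : R * R) : set (R * R) :=
  [set conv2 t a b | t in [set: {i01 R}]].

Definition extreme_points (R : realType) (K : set (R * R)) : set (R * R) :=
  [set p | K p /\ forall (a b : R * R) (t : {i01 R}), K a -> K b ->
     0 < t%:num < 1 -> p = conv2 t a b -> a = p /\ b = p].

Section covariance.
Variable R : realType.

Let mu := ((@lebesgue_measure R) \x (@lebesgue_measure R))%E.

Definition area (K : set (R * R)) : R := fine (mu K).

Definition coord (i : 'I_2) (u : R * R) : R := if i == ord0 then u.1 else u.2.

Definition Cov (K : set (R * R)) : 'M[R]_2 :=
  \matrix_(i, j)
    ((\int[mu]_(u in K) (coord i u * coord j u)) / area K
     - (\int[mu]_(u in K) coord i u) / area K
       * ((\int[mu]_(u in K) coord j u) / area K)).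

Definition calC (K : set (R * R)) : R := area K ^+ 2 / \det (Cov K).

End covariance.

(* Twice the signed area of the triangle a, b, c: nonnegative iff c lies on the
   left of (or on) the line directed from a to b. *)
Definition orient (R : realType) (a b c : R * R) : R :=
  (b.1 - a.1) * (c.2 - a.2) - (b.2 - a.2) * (c.1 - a.1).

(* The vertices are v 1, ..., v m; the other values of v are irrelevant. *)
Definition idx (m : nat) : set nat := [set i | (1 <= i <= m)%N].

Definition polygon (R : realType) (m : nat) (v : nat -> R * R) : set (R * R) :=
  co [set v i | i in idx m].

Definition polygon_hat (R : realType) (m : nat) (v : nat -> R * R)
    : set (R * R) :=
  co [set v i | i in idx m `\ 2%N].

Record class_P (R : realType) (m : nat) (v : nat -> R * R) : Prop := {
  class_P_size : (3 < m)%N ;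
  class_P_inj : {in idx m &, injective v} ;
  class_P_extreme : extreme_points (polygon m v) = [set v i | i in idx m] ;
  (* (i %% m).+1 is the cyclic successor of i in 1, ..., m.  Counter-clockwise
     means that the polygon stays on the left of each directed side. *)
  class_P_ccw : forall i, idx m i -> forall q, polygon m v q ->
    0 <= orient (v i) (v (i %% m).+1) q ;
  class_P_x : (v 3%N).1 <= (v 2%N).1 <= (v 1%N).1 ;
  class_P_y1 : 0 <= (v 1%N).2 ;
  class_P_y13 : (v 1%N).2 = (v 3%N).2 ;
  class_P_y32 : (v 3%N).2 < (v 2%N).2 ;
  class_P_int : (interior (polygon_hat m v)) (0, 0)
}.

Definition mahler_slide (R : realType) (m : nat) (v : nat -> R * R) (t : R)
    : set (R * R) :=
  polygon m [eta v with 2%N |-> (t, (v 2%N).2)].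

(* Main.v *)
Require Import Defs.
From HB Require Import structures.
From mathcomp Require Import all_boot all_order all_algebra.
From mathcomp Require Import all_classical all_reals all_analysis.
From mathcomp Require Import measurable_realfun ring lra.
Import Order.TTheory GRing.Theory Num.Theory numFieldNormedType.Exports.

(** Cut the polygon along the horizontal chord from v 3 to v 1. Every vertex
    other than v 2 lies on or below the chord, so the part below it is
    polygon_hat, which does not depend on t; the part above it, the cap, is the
    triangle with vertices v 1, (t, (v 2).2), v 3. This description stays true
    for t in [xil, xir] because the two sides that meet in the slid apex then
    still have the whole of polygon_hat on their left (slideE).

    Let g y be the height of y above the chord divided by the height of the
    cap, and 0 below the chord. Moving the apex by s turns the polygon into its
    image under (x, y) |-> (x + s * g y, y) (preimage_slide), and this map
    preserves area, since it translates every horizontal line (leb2_shear). So,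
    if (X, Y) is uniformly distributed in the polygon at t = u, then the
    polygon at t = u + s has the same area a and the covariance matrix of
    (X + s * g Y, Y), and

      1 / C = (Var (X + s * g Y) * Var Y - Cov (X + s * g Y, Y) ^ 2) / a ^ 2

    is a polynomial of degree at most 2 in s (inv_calC_shear). Its coefficient
    of s ^ 2 is (Var (g Y) * Var Y - Cov (g Y, Y) ^ 2) / a ^ 2, which
    Cauchy-Schwarz makes nonnegative; it is positive because g Y is not an
    affine function of Y: g vanishes below the chord and grows above it, and the
    polygon has interior points on both sides (ramp_nondegenerate). A quadratic
    polynomial with positive leading coefficient is convex. *)

Local Open Scope classical_set_scope.
Local Open Scope ring_scope.

Local Notation leb2 R :=
  ((@lebesgue_measure R) \x (@lebesgue_measure R))%E.

(** * Lebesgue measure of the plane *)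

Lemma measurable_shift {R : realType} (c : R) :
  measurable_fun [set: measurableTypeR R]
    (fun x : measurableTypeR R => (x + c : measurableTypeR R)).
Proof. by apply: measurable_funD. Qed.

(** Lebesgue measure is determined by its values on half-open intervals, and
    those are visibly translation invariant. *)
Lemma lebesgue_measure_shift {R : realType} (c : R) (A : set R) :
  measurable A ->
  lebesgue_measure ((fun x => x + c) @^-1` A) = lebesgue_measure A.
Proof.
move=> mA.
have mshift := measurable_shift c.
pose nu : {measure set (measurableTypeR R) -> \bar R} :=
  pushforward (@lebesgue_measure R)
    (fun x : measurableTypeR R => (x + c : measurableTypeR R)).
rewrite [RHS](@lebesgue_measure_unique R (nu mshift)) //= => _ [[a b] _ <-].
rewrite /nu /= /pushforward /=.
have -> : (fun x : R => x + c) @^-1` `]a, b]%classic = `]a - c, b - c]%classic.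
  by apply/seteqP; split => x /=; rewrite !in_itv /= ltrBlDr lerBrDr.
rewrite !lebesgue_measure_itv /= !lte_fin ltrD2r.
by case: ifP => // _; rewrite -!EFinD; congr EFin; ring.
Qed.

(** The Borel sets of the product topology belong to the product
    sigma-algebra, because an open set is the union of the countably many
    squares with rational centre and radius that it contains. *)
Lemma open_measurable2 {R : realType} (A : set (R * R)) :
  open A -> measurable A.
Proof.
move=> oA.
pose B (k : rat * rat * rat) : set (R * R) :=
  let p : R * R := (ratr k.1.1, ratr k.1.2) in let e : R := ratr k.2 in
  if `[< ball p e `<=` A >] then ball p e else set0.
have -> : A = \bigcup_k B k.
  apply/seteqP; split => [x Ax|x [k _]]; last first.
    by rewrite /B; case: asboolP => // /[apply].
  have /nbhs_ballP [e /= e0 xeA] : nbhs x A by apply: open_nbhs_nbhs.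
  (* A radius in ]e/4, e/2[ and a centre within e/4 of x: the square contains x,
     and none of its points is further than 3e/4 from x. *)
  have e20 : e / 4%:R < e / 2%:R by lra.
  have [r] := rat_in_itvoo e20; rewrite in_itv /= => /andP[r1 r2].
  have near y : exists q : rat, `|y - ratr q| < e / 4%:R.
    have : y - e / 4%:R < y + e / 4%:R by lra.
    move=> /rat_in_itvoo [q]; rewrite in_itv /= => /andP[q1 q2].
    by exists q; rewrite ltr_distlC; apply/andP; split; lra.
  have [q1 hq1] := near x.1; have [q2 hq2] := near x.2.
  exists (q1, q2, r) => //; rewrite /B; case: asboolP => /= [_|].
    by split; rewrite /ball /= distrC; lra.
  case => y yB; apply: xeA; move: yB => /= [y1 y2]; rewrite /ball /= in y1 y2.
  split; rewrite /ball /=.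
    rewrite -(subrK (ratr q1) x.1) -addrA (le_lt_trans (ler_normD _ _)) //; lra.
  rewrite -(subrK (ratr q2) x.2) -addrA (le_lt_trans (ler_normD _ _)) //; lra.
apply: countable_bigcupT_measurable => [|k]; first exact: countableP.
rewrite /B /=; case: asboolP => [_|_]; last exact: measurable0.
by apply: measurableX; exact: measurable_ball.
Qed.

Lemma continuous_measurable_fun2 {R : realType} (f : R * R -> R) :
  continuous f -> measurable_fun [set: R * R] f.
Proof.
move=> /continuousP cf; apply: (measurability _ (RGenOpens.measurableE R)).
move=> _ [_ [a [b ->] <-]]; rewrite setTI; apply: open_measurable2.
exact/cf/interval_open.
Qed.

Lemma compact_measurable2 {R : realType} (A : set (R * R)) :
  compact A -> measurable A.
Proof.
move=> cA; rewrite -[A]setCK; apply: measurableC; apply: open_measurable2.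
by apply: closed_openC; apply: compact_closed => //; exact: norm_hausdorff.
Qed.

Lemma compact_finite_measure2 {R : realType} (A : set (R * R)) :
  compact A -> (leb2 R A < +oo)%E.
Proof.
move=> cA; have [M [_ /(_ (`|M| + 1))]] := compact_bounded cA.
have /[swap]/[apply] : M < `|M| + 1 by rewrite ltr_pwDr // ler_norm.
set N := `|M| + 1 => AN.
have AI : A `<=` `[- N, N]%classic `*` `[- N, N]%classic.
  move=> p /AN; rewrite /= ge_max => /andP[p1 p2].
  by split; rewrite /= in_itv /= -ler_norml.
apply: (@le_lt_trans _ _ (leb2 R (`[- N, N]%classic `*` `[- N, N]%classic))).
  apply: le_measure => //; rewrite inE; first exact: compact_measurable2.
  exact: measurableX.
rewrite product_measure1E //= !lebesgue_measure_itv /=.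
by case: ifP => _; rewrite ?mule0 ?mul0e ?ltry // -EFinD -EFinM ltry.
Qed.

Lemma continuous_compact_integrable2 {R : realType} (A : set (R * R))
    (f : R * R -> R) :
  compact A -> continuous f -> (leb2 R).-integrable A (EFin \o f).
Proof.
move=> cA cf; apply: measurable_bounded_integrable.
- exact: compact_measurable2.
- exact: compact_finite_measure2.
- by apply: measurable_funTS; exact: continuous_measurable_fun2.
- have := compact_bounded (continuous_compact (continuous_subspaceT cf) cA).
  move=> [M [Mr hM]]; exists M; split => // x Mx y Ay.
  by apply: hM => //; exists y.
Qed.

(** * Shears along the first axis *)

Definition shear {R : realType} (g : R -> R) (s : R) (p : R * R) : R * R :=
  (p.1 + s * g p.2, p.2).

Lemma measurable_shear {R : realType} (g : R -> R) (s : R) :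
  continuous g -> measurable_fun [set: R * R] (shear g s).
Proof.
move=> cg; apply: measurable_fun_pair => //.
apply: measurable_funD => //; apply: measurable_funM => //.
by apply: measurableT_comp => //; exact: continuous_measurable_fun.
Qed.

(** Cavalieri's principle: a shear translates each horizontal section. *)
Lemma leb2_shear {R : realType} (g : R -> R) (s : R) (A : set (R * R)) :
  continuous g -> measurable A -> leb2 R (shear g s @^-1` A) = leb2 R A.
Proof.
move=> cg mA.
have leb2E X : measurable X ->
    leb2 R X = (\int[lebesgue_measure]_y lebesgue_measure (ysection X y))%E.
  move=> mX; apply: (product_measure_unique
    (m' := (@lebesgue_measure R \x^ @lebesgue_measure R)%E)) => //.
  by move=> *; exact: product_measure2E.
rewrite !leb2E //; last first.
  by rewrite -[X in measurable X]setTI; exact: measurable_shear.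
apply: eq_integral => y _.
rewrite -[RHS](@lebesgue_measure_shift R (s * g y)) //.
exact: measurable_ysection.
Qed.

Lemma Rintegral_shear {R : realType} (g : R -> R) (s : R) (A : set (R * R))
    (F : R * R -> R) :
  continuous g -> measurable A -> measurable_fun [set: R * R] F ->
  (leb2 R).-integrable (shear g s @^-1` A) (EFin \o (F \o shear g s)) ->
  \int[leb2 R]_(p in A) F p =
  \int[leb2 R]_(p in shear g s @^-1` A) F (shear g s p).
Proof.
(* R carries two measurable structures with the same measurable sets, indexed by
   different displays; the Lebesgue measure lives on measurableTypeR R, and
   transport along the shear has to be stated there. *)
move=> cg mA mF iF; pose T := (measurableTypeR R * measurableTypeR R)%type.
have ms : measurable_fun [set: T] (shear g s : T -> T).
  exact: measurable_shear.
have mEF : measurable_fun [set: T] (EFin \o F) by exact/measurable_EFinP.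
rewrite /Rintegral; congr fine.
have <- := integral_pushforward ms mEF iF mA.
by apply: eq_measure_integral => B mB _; exact/esym/leb2_shear.
Qed.

(** Near p the square exceeds half of its value at p. *)
Lemma Rintegral_sqr_gt0 {R : realType} (K : set (R * R)) (h : R * R -> R) p :
  compact K -> continuous h -> interior K p -> h p != 0 ->
  0 < \int[leb2 R]_(q in K) (h q ^+ 2).
Proof.
move=> cK ch Kp hp0.
have ch2 : continuous (fun q => h q ^+ 2).
  by move=> q; apply: continuousM; exact: ch.
pose d := h p ^+ 2 / 2.
have d0 : 0 < d by rewrite divr_gt0 // exprn_even_gt0.
have dp : d < h p ^+ 2.
  by rewrite ltr_pdivrMr // ltr_pMr ?ltr1n // exprn_even_gt0.
have : \forall q \near p, K q /\ d < h q ^+ 2.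
  apply: filterI; first exact: Kp.
  by apply: (ch2 p [set y | d < y]); exact: lt_nbhsr.
move=> /nbhs_ballP [e /= e0 BU].
have mB : measurable (ball p e) by apply: measurableX; exact: measurable_ball.
have BK : ball p e `<=` K by move=> q /BU [].
have muB : (leb2 R (ball p e) = ((e *+ 2) * (e *+ 2))%:E)%E.
  transitivity
    (lebesgue_measure (ball p.1 e) * lebesgue_measure (ball p.2 e))%E.
    by apply: product_measure1E; exact: measurable_ball.
  by rewrite !lebesgue_measure_ball ?ltW // -EFinM.
have iK := continuous_compact_integrable2 K _ cK ch2.
have mK := compact_measurable2 K cK.
apply: (@lt_le_trans _ _ (\int[leb2 R]_(q in ball p e) d)).
  rewrite Rintegral_cst //.
  rewrite [X in d * X](congr1 fine muB : fine _ = e *+ 2 * (e *+ 2)).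
  by apply: mulr_gt0 => //; apply: mulr_gt0; rewrite mulr2n addr_gt0.
apply: (@le_trans _ _ (\int[leb2 R]_(q in ball p e) (h q ^+ 2))).
  apply: le_Rintegral => //.
  - apply: measurable_bounded_integrable => //.
      by rewrite [X in (X < _)%E]muB ltry.
    exists `|d|; split => // x dx q _ /=; exact: ltW.
  - exact: integrableS iK.
  - by move=> q /BU [_ /ltW].
rewrite /Rintegral fine_le //.
- by apply: integrable_fin_num => //; exact: integrableS iK.
- exact: integrable_fin_num.
apply: ge0_subset_integral => //.
- exact: (measurable_int (leb2 R)).
- by move=> q _; rewrite lee_fin sqr_ge0.
Qed.

(** * Moments of a compact set and of its shears *)

(** A name for continuity on the plane that unification leaves folded, so that
    planar_continuity can read off the expression of the function. *)
Definition planar_continuous {R : realType} (f : R * R -> R) : Prop :=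
  continuous f.

Lemma planar_continuousD {R : realType} (f h : R * R -> R) :
  planar_continuous f -> planar_continuous h ->
  planar_continuous (fun p => f p + h p).
Proof. by move=> cf ch p; apply: continuousD; [exact: cf|exact: ch]. Qed.

Lemma planar_continuousM {R : realType} (f h : R * R -> R) :
  planar_continuous f -> planar_continuous h ->
  planar_continuous (fun p => f p * h p).
Proof. by move=> cf ch p; apply: continuousM; [exact: cf|exact: ch]. Qed.

Lemma planar_continuous_fst {R : realType} :
  planar_continuous (fun p : R * R => p.1).
Proof. by move=> p; exact: cvg_fst. Qed.

Lemma planar_continuous_comp_snd {R : realType} (g : R -> R) :
  continuous g -> planar_continuous (fun p : R * R => g p.2).
Proof. by move=> cg p; apply: continuous_comp; [exact: cvg_snd|exact: cg]. Qed.

Lemma planar_continuous_snd {R : realType} :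
  planar_continuous (fun p : R * R => p.2).
Proof. by move=> p; exact: cvg_snd. Qed.

Lemma planar_continuous_cst {R : realType} (c : R) :
  planar_continuous (fun _ : R * R => c).
Proof. by move=> p; exact: cvg_cst. Qed.

Ltac planar_continuity :=
  lazymatch goal with
  | |- @planar_continuous _ (fun p => @?f p + @?h p) =>
      apply: (planar_continuousD f h); planar_continuity
  | |- @planar_continuous _ (fun p => @?f p * @?h p) =>
      apply: (planar_continuousM f h); planar_continuity
  | |- @planar_continuous _ (fun p => p.1) => exact: planar_continuous_fst
  | |- @planar_continuous _ (fun p => p.2) => exact: planar_continuous_snd
  | |- @planar_continuous _ (fun p => ?g p.2) =>
      apply: (planar_continuous_comp_snd g); assumption
  | |- @planar_continuous _ fst => exact: planar_continuous_fst
  | |- @planar_continuous _ snd => exact: planar_continuous_snd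
  | |- @planar_continuous _ (fun _ => ?c) => exact: (planar_continuous_cst c)
  end.

Lemma Rintegral_compactD {R : realType} (K : set (R * R)) (f h : R * R -> R) :
  compact K -> planar_continuous f -> planar_continuous h ->
  \int[leb2 R]_(p in K) (f p + h p) =
  \int[leb2 R]_(p in K) f p + \int[leb2 R]_(p in K) h p.
Proof.
move=> cK cf ch; apply: RintegralD; first exact: compact_measurable2.
  exact: continuous_compact_integrable2.
exact: continuous_compact_integrable2.
Qed.

Lemma Rintegral_compactZ {R : realType} (K : set (R * R)) (c : R)
    (f : R * R -> R) :
  compact K -> planar_continuous f ->
  \int[leb2 R]_(p in K) (c * f p) = c * \int[leb2 R]_(p in K) f p.
Proof.
move=> cK cf; apply: RintegralZl; first exact: compact_measurable2.
exact: continuous_compact_integrable2.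
Qed.

(** Here gg, gy, yy, g1, y1, A are the integrals of g^2, gy, y^2, g, y, 1, and
    the hypothesis says that the Gram matrix of (g, y, 1) is positive definite,
    that is, that every nontrivial a * g + b * y + c has positive square
    integral. The conclusion is the strict Cauchy-Schwarz inequality for the
    centred functions. *)
Lemma reduced_gram_gt0 {R : realType} (gg gy yy g1 y1 A : R) :
  (forall a b c, [|| a != 0, b != 0 | c != 0] ->
    0 < a ^+ 2 * gg + 2 * a * b * gy + b ^+ 2 * yy
        + 2 * a * c * g1 + 2 * b * c * y1 + c ^+ 2 * A) ->
  0 < A /\ 0 < (gg / A - (g1 / A) ^+ 2) * (yy / A - (y1 / A) ^+ 2)
      - (gy / A - g1 / A * (y1 / A)) ^+ 2.
Proof.
move=> Q.
have A0 : 0 < A.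
  have := Q 0 0 1; rewrite oner_eq0 !orbT => /(_ isT); lra.
have A1 : A != 0 by rewrite gt_eqF.
pose c0 := A * yy - y1 ^+ 2; pose b0 := A * gy - g1 * y1.
pose a0 := A * gg - g1 ^+ 2.
have c0_gt0 : 0 < c0.
  have := Q 0 A (- y1); rewrite A1 orbT => /(_ isT).
  have -> : 0 ^+ 2 * gg + 2 * 0 * A * gy + A ^+ 2 * yy + 2 * 0 * - y1 * g1 +
    2 * A * - y1 * y1 + (- y1) ^+ 2 * A = A * c0 by rewrite /c0; ring.
  by rewrite pmulr_rgt0.
(* Multiplied by A * c0, this is the form at a multiple of the component of g
   orthogonal to both y and 1. *)
have D0 : 0 < a0 * c0 - b0 ^+ 2.
  have := Q (A * c0) (- (A * b0)) (- (c0 * g1 - b0 * y1)).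
  rewrite mulf_neq0 ?(gt_eqF c0_gt0) //= => /(_ isT).
  set q := (X in 0 < X); have -> : q = A * c0 * (a0 * c0 - b0 ^+ 2).
    by rewrite /q /a0 /b0 /c0; ring.
  by rewrite pmulr_rgt0 // mulr_gt0.
split => //; set d := (X in 0 < X).
have -> : d = (a0 * c0 - b0 ^+ 2) / A ^+ 4.
  by rewrite /d /a0 /b0 /c0; field.
by rewrite divr_gt0 // exprn_gt0.
Qed.

(** The set A is the image of K under the shear with parameter s. By area
    preservation its moments are those of (x + s * g y, y) over K. Hence Cov A
    has one entry quadratic in s, two entries affine in s and one constant
    entry, and its determinant is quadratic with leading coefficient
    Var g * Var y - Cov (g, y) ^ 2; the nondegeneracy hypothesis makes this
    positive. The triple q lists the coefficients, highest degree first. *)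
Lemma inv_calC_shear {R : realType} (K : set (R * R)) (g : R -> R) :
  compact K -> continuous g ->
  (forall a b c, [|| a != 0, b != 0 | c != 0] ->
    exists2 p, interior K p & a * g p.2 + b * p.2 + c != 0) ->
  exists q : R * R * R, 0 < q.1.1 /\
    forall (s : R) (A : set (R * R)), compact A -> shear g s @^-1` A = K ->
    (calC A)^-1 = q.1.1 * s ^+ 2 + q.1.2 * s + q.2.
Proof.
move=> cK cg nondeg.
pose M (F : R * R -> R) := \int[leb2 R]_(p in K) F p.
case: (@reduced_gram_gt0 R (M (fun p => g p.2 * g p.2))
  (M (fun p => g p.2 * p.2)) (M (fun p => p.2 * p.2))
  (M (fun p => g p.2)) (M (fun p => p.2)) (M (fun p => 1))).
  move=> a b c /nondeg [p Kp hp].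
  have ch : planar_continuous (fun p : R * R => a * g p.2 + b * p.2 + c).
    by planar_continuity.
  have := @Rintegral_sqr_gt0 R K _ p cK ch Kp hp.
  have -> : \int[leb2 R]_(q in K) ((a * g q.2 + b * q.2 + c) ^+ 2) =
    M (fun q => a ^+ 2 * (g q.2 * g q.2) + (2 * a * b) * (g q.2 * q.2)
      + b ^+ 2 * (q.2 * q.2) + (2 * a * c) * (g q.2)
      + (2 * b * c) * q.2 + c ^+ 2 * 1).
    by apply: eq_Rintegral => q _; ring.
  by rewrite /M !(Rintegral_compactD, Rintegral_compactZ) //; planar_continuity.
move=> A0 alpha0; have area1 : M (fun=> 1) = area K.
  by rewrite /M Rintegral_cst ?mul1r //; exact: compact_measurable2.
rewrite area1 in A0 alpha0.
set Mgg := M (fun p => g p.2 * g p.2) in alpha0.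
set Mgy := M (fun p => g p.2 * p.2) in alpha0.
set Myy := M (fun p => p.2 * p.2) in alpha0.
set Mg := M (fun p => g p.2) in alpha0.
set My := M (fun p => p.2) in alpha0.
pose Mxx := M (fun p => p.1 * p.1).
pose Mxy := M (fun p => p.1 * p.2).
pose Mxg := M (fun p => p.1 * g p.2).
pose Mx := M (fun p => p.1).
pose a := area K.
exists (((Mgg / a - (Mg / a) ^+ 2) * (Myy / a - (My / a) ^+ 2)
    - (Mgy / a - Mg / a * (My / a)) ^+ 2) / a ^+ 2,
  (2 * (Mxg / a - Mx / a * (Mg / a)) * (Myy / a - (My / a) ^+ 2)
    - 2 * (Mxy / a - Mx / a * (My / a)) * (Mgy / a - Mg / a * (My / a)))
    / a ^+ 2,
  ((Mxx / a - (Mx / a) ^+ 2) * (Myy / a - (My / a) ^+ 2)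
    - (Mxy / a - Mx / a * (My / a)) ^+ 2) / a ^+ 2).
split; first by rewrite divr_gt0 // exprn_gt0.
move=> s A cA AK; have mA := compact_measurable2 A cA.
have areaA : area A = a by rewrite /area /a /area -AK leb2_shear.
have MA F : planar_continuous F -> planar_continuous (F \o shear g s) ->
    \int[leb2 R]_(p in A) F p = M (fun p => F (p.1 + s * g p.2, p.2)).
  move=> cF cFs; rewrite (@Rintegral_shear R g s) ?AK //.
    exact: continuous_measurable_fun2.
  exact: continuous_compact_integrable2.
have MAxx :
    \int[leb2 R]_(p in A) (p.1 * p.1) = Mxx + (2 * s) * Mxg + s ^+ 2 * Mgg.
  rewrite MA /comp /=; [|planar_continuity..].
  transitivity (M (fun p => p.1 * p.1 + (2 * s) * (p.1 * g p.2)
    + s ^+ 2 * (g p.2 * g p.2))); first by apply: eq_Rintegral => p _; ring.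
  by rewrite /M !(Rintegral_compactD, Rintegral_compactZ) //; planar_continuity.
have MAxy : \int[leb2 R]_(p in A) (p.1 * p.2) = Mxy + s * Mgy.
  rewrite MA /comp /=; [|planar_continuity..].
  transitivity (M (fun p => p.1 * p.2 + s * (g p.2 * p.2))).
    by apply: eq_Rintegral => p _; ring.
  by rewrite /M !(Rintegral_compactD, Rintegral_compactZ) //; planar_continuity.
have MAyx : \int[leb2 R]_(p in A) (p.2 * p.1) = Mxy + s * Mgy.
  by rewrite -MAxy; apply: eq_Rintegral => p _; rewrite mulrC.
have MAyy : \int[leb2 R]_(p in A) (p.2 * p.2) = Myy.
  by rewrite MA /comp /=; [|planar_continuity..].
have MAx : \int[leb2 R]_(p in A) p.1 = Mx + s * Mg.
  rewrite MA /comp /=; [|planar_continuity..].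
  by rewrite /M !(Rintegral_compactD, Rintegral_compactZ) //; planar_continuity.
have MAy : \int[leb2 R]_(p in A) p.2 = My.
  by rewrite MA /comp /=; [|planar_continuity..].
have det2 (B : 'M[R]_2) : \det B = B 0 0 * B 1 1 - B 0 1 * B 1 0.
  rewrite (expand_det_row B 0) !big_ord_recl big_ord0 addr0 /cofactor.
  rewrite !det_mx11 !mxE.
  rewrite expr0 mul1r expr1 mulN1r mulrN.
  by congr (_ * B _ _ - B _ _ * B _ _); apply/val_inj.
rewrite /calC invf_div areaA det2 /Cov !mxE areaA /coord /=.
rewrite MAxx MAxy MAyx MAyy MAx MAy.
have a0 : a != 0 by rewrite gt_eqF.
by field.
Qed.

(** * Convex hulls of finite sets *)

(** The barycenter conv2 with a plain real weight, so that weights can be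
    computed without proofs attached. *)
Definition mix {R : realType} (s : R) (a b : R * R) : R * R :=
  (s * a.1 + (1 - s) * b.1, s * a.2 + (1 - s) * b.2).

Lemma mix_conv2 {R : realType} (s : R) (a b : R * R) :
  0 <= s -> s <= 1 -> exists2 t : {i01 R}, t%:num = s & mix s a b = conv2 t a b.
Proof.
move=> s0 s1.
have st : Itv.spec (@Itv.num_sem R) (Itv.Real `[0%Z, 1%Z]) s.
  by rewrite /Itv.num_sem /= in_itv /= s0 s1 num_real.
by exists (Itv.mk st).
Qed.

Lemma convex2P {R : realType} (A : set (R * R)) :
  convex2 A <-> (forall s a b, 0 <= s -> s <= 1 -> A a -> A b -> A (mix s a b)).
Proof.
split => [cA s a b s0 s1 Aa Ab|cA a b t].
  have [t _ ->] := mix_conv2 s a b s0 s1.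
  by have /set_mem := cA a b t (mem_set Aa) (mem_set Ab).
move=> /set_mem Aa /set_mem Ab; apply/mem_set.
by apply: cA => //.
Qed.

Lemma segmentP {R : realType} (a b p : R * R) :
  segment a b p <-> exists s, [/\ 0 <= s, s <= 1 & p = mix s a b].
Proof.
split=> [[t _ <-]|[s [s0 s1 ->]]]; first by exists t%:num; split.
by have [t _ ->] := mix_conv2 s a b s0 s1; exists t.
Qed.

Lemma convex_co {R : realType} (A : set (R * R)) : convex2 (co A).
Proof.
apply/convex2P => s a b s0 s1 ha hb C [cC AC].
by move/convex2P : (cC); apply => //; [exact: ha|exact: hb].
Qed.

Lemma sub_co {R : realType} (A : set (R * R)) : A `<=` co A.
Proof. exact: sub_smallest. Qed.

Definition join {R : realType} (w : R * R) (C : set (R * R)) : set (R * R) :=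
  [set p | exists s q, [/\ 0 <= s, s <= 1, C q & p = mix s w q]].

(** A combination of two points of the join gives the apex the combined weight
    of the two, and the rest of the weight, k1 + k2, to a point between q1
    and q2. *)
Lemma join_convex {R : realType} (w : R * R) (C : set (R * R)) :
  convex2 C -> convex2 (join w C).
Proof.
move=> /convex2P cC; apply/convex2P => r _ _ r0 r1
  [s1 [q1 [s10 s11 Cq1 ->]]] [s2 [q2 [s20 s21 Cq2 ->]]].
pose k1 := r * (1 - s1); pose k2 := (1 - r) * (1 - s2).
have k10 : 0 <= k1 by apply: mulr_ge0; lra.
have k20 : 0 <= k2 by apply: mulr_ge0; lra.
have rs1 : 0 <= r * s1 by apply: mulr_ge0; lra.
have rs2 : 0 <= (1 - r) * s2 by apply: mulr_ge0; lra.
exists (r * s1 + (1 - r) * s2).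
(* All the weight is on w, and any point of C will do as the other end. *)
have [k0|k0] := eqVneq (k1 + k2) 0.
  exists q1; split=> //; first by rewrite addr_ge0.
    by move: k10 k20 k0; rewrite /k1 /k2; lra.
  have k1E : k1 = 0 by lra.
  have k2E : k2 = 0 by lra.
  have E : r * s1 + (1 - r) * s2 = 1 by move: k1E k2E; rewrite /k1 /k2; lra.
  rewrite E /mix /=; congr pair.
    transitivity ((r * s1 + (1 - r) * s2) * w.1 + k1 * q1.1 + k2 * q2.1).
      by rewrite /k1 /k2; ring.
    by rewrite E k1E k2E; ring.
  transitivity ((r * s1 + (1 - r) * s2) * w.2 + k1 * q1.2 + k2 * q2.2).
    by rewrite /k1 /k2; ring.
  by rewrite E k1E k2E; ring.
have kp : 0 < k1 + k2 by rewrite lt_neqAle eq_sym k0 addr_ge0.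
exists (mix (k1 / (k1 + k2)) q1 q2); split.
- by rewrite addr_ge0.
- by move: k10 k20; rewrite /k1 /k2; lra.
- apply: cC => //; first by rewrite divr_ge0 // ltW.
  by rewrite ler_pdivrMr //; lra.
- have kE : k1 / (k1 + k2) * (k1 + k2) = k1 by rewrite divfK.
  have E : 1 - (r * s1 + (1 - r) * s2) = k1 + k2 by rewrite /k1 /k2; ring.
  rewrite /mix /= E; congr pair.
    transitivity ((r * s1 + (1 - r) * s2) * w.1 + k1 * q1.1 + k2 * q2.1).
      by rewrite /k1 /k2; ring.
    by field.
  transitivity ((r * s1 + (1 - r) * s2) * w.2 + k1 * q1.2 + k2 * q2.2).
    by rewrite /k1 /k2; ring.
  by field.
Qed.

Lemma co_setU1 {R : realType} (w : R * R) (F : set (R * R)) :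
  F !=set0 -> co (w |` F) = join w (co F).
Proof.
move=> [f Ff]; apply/seteqP; split.
  apply: smallest_sub; first exact/join_convex/convex_co.
  move=> p [->|Fp].
    exists 1, f; split => //; first exact: sub_co.
    by rewrite /mix; case: w => w1 w2 /=; congr pair; ring.
  exists 0, p; split => //; first exact: sub_co.
  by rewrite /mix; case: p {Fp} => p1 p2 /=; congr pair; ring.
move=> p [s [q [s0 s1 cq ->]]].
have /convex2P := convex_co (w |` F); apply => //.
  by apply: sub_co; left.
move=> C [cC FC]; apply: cq; split => // x Fx; apply: FC; by right.
Qed.

Lemma compact_join {R : realType} (w : R * R) (C : set (R * R)) :
  compact C -> compact (join w C).
Proof.
move=> cC.
pose f (x : R * (R * R)) : R * R := mix x.1 w x.2.
have -> : join w C = f @` (`[0, 1]%classic `*` C).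
  apply/seteqP; split
    => [p [s [q [s0 s1 Cq ->]]]|_ [[s q] [/= /[!in_itv]/= /andP[s0 s1] Cq] <-]].
    by exists (s, q) => //; split => //=; rewrite in_itv /= s0 s1.
  by exists s, q.
apply: continuous_compact; last exact: compact_setX (@segment_compact R 0 1) cC.
apply: continuous_subspaceT => x.
have h (g : R * R -> R) (c : R) : continuous g ->
    (fun x : R * (R * R) => x.1 * c + (1 - x.1) * g x.2) @ x -->
    x.1 * c + (1 - x.1) * g x.2.
  move=> cg; apply: cvgD; apply: cvgM.
  - exact: cvg_fst.
  - exact: cvg_cst.
  - by apply: cvgB; [exact: cvg_cst|exact: cvg_fst].
  - by apply: (continuous_comp (f := snd) (g := g)); [exact: cvg_snd|exact: cg].
have cfst : continuous (fst : R * R -> R) by move=> p; exact: cvg_fst.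
have csnd : continuous (snd : R * R -> R) by move=> p; exact: cvg_snd.
exact: (cvg_pair (h _ w.1 cfst) (h _ w.2 csnd)).
Qed.

(** Adding a vertex turns the hull into the join of that vertex with it, a
    continuous image of the product of [0, 1] and the hull. *)
Lemma compact_co_finite {R : realType} (F : set (R * R)) :
  finite_set F -> compact (co F).
Proof.
move=> /finite_seqP [s ->] {F}; elim: s => [|w s IH].
  have -> : co [set` [::]] = set0 :> set (R * R); last exact: compact0.
  by rewrite set_nil; apply: smallest_id => a b t; rewrite inE.
have -> : [set` w :: s] = w |` [set` s].
  by apply/seteqP; split => x /=; rewrite inE => /predU1P.
case: s IH => [_|a s IH].
  rewrite set_nil setU0.
  have -> : co [set w] = [set w]; last exact: compact_set1.
  apply: smallest_id; apply/convex2P => s a b _ _ -> ->.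
  by rewrite /mix; case: w => w1 w2 /=; congr pair; ring.
rewrite co_setU1; first exact: compact_join.
by exists a; rewrite /= inE eqxx.
Qed.

(** * The cap above a horizontal chord *)

Lemma orient_mix {R : realType} (s : R) (a b p q : R * R) :
  orient a b (mix s p q) = s * orient a b p + (1 - s) * orient a b q.
Proof. by rewrite /orient /mix /=; ring. Qed.

Lemma orient_endr {R : realType} (a b : R * R) : orient a b b = 0.
Proof. by rewrite /orient; ring. Qed.

Lemma orient_endl {R : realType} (a b : R * R) : orient a b a = 0.
Proof. by rewrite /orient; ring. Qed.

Lemma convex_orient {R : realType} (a b : R * R) :
  convex2 [set q | 0 <= orient a b q].
Proof.
apply/convex2P => s p q s0 s1 /= hp hq.
by rewrite orient_mix addr_ge0 // mulr_ge0 // subr_ge0.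
Qed.

Lemma convex_below {R : realType} (c : R) : convex2 [set q : R * R | q.2 <= c].
Proof. by apply/convex2P => s p q s0 s1 /= hp hq; nra. Qed.

(** When a and b are at the same height, w above them and b on the left of a,
    this is the full triangle a, w, b. It is described by inequalities, because
    these are what the orientation of the polygon provides and what a shear
    transforms simply. *)
Definition cap {R : realType} (a w b : R * R) : set (R * R) :=
  [set p | [/\ a.2 <= p.2, 0 <= orient a w p & 0 <= orient w b p]].

Lemma cap_sub_join {R : realType} (a w b p : R * R) :
  a.2 = b.2 -> a.2 < w.2 -> b.1 < a.1 -> cap a w b p ->
  join w (segment a b) p.
Proof.
case: a w b p => [a1 a2] [w1 w2] [b1 b2] [p1 p2] /= <- aw ba.
rewrite /cap /orient /= => -[h1 h2 h3].
have pw : p2 <= w2 by nra.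
pose s := (p2 - a2) / (w2 - a2).
have wa0 : w2 - a2 != 0 by lra.
have sE : s * (w2 - a2) = p2 - a2 by rewrite /s divfK.
have s0 : 0 <= s by rewrite divr_ge0 //; lra.
have s1 : s <= 1 by rewrite ler_pdivrMr; lra.
(* At the height of the apex the projection to the chord is undefined, but the
   only such point of the cap is the apex. *)
move: pw; rewrite le_eqVlt => /predU1P[pE|pw].
  exists 1, (a1, a2); split => //.
    by apply/segmentP; exists 1; split => //; rewrite /mix /=; congr pair; ring.
  by rewrite /mix /= -pE; congr pair; [nra|ring].
have s1' : s < 1 by rewrite ltr_pdivrMr; lra.
(* The ray from w through p meets the line of the chord at abscissa c. *)
pose c := (p1 - s * w1) / (1 - s).
have cE : c * (1 - s) = p1 - s * w1 by rewrite /c divfK //; lra.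
exists s, (c, a2); split => //; last first.
  by rewrite /mix /=; congr pair; nra.
have wp : (1 - s) * (w2 - a2) = w2 - p2 by lra.
have ca : c <= a1.
  have : 0 <= (w2 - a2) * ((1 - s) * (a1 - c)).
    have -> : (w2 - a2) * ((1 - s) * (a1 - c)) =
      (w1 - a1) * (p2 - a2) - (w2 - a2) * (p1 - a1).
      rewrite -sE; transitivity ((w2 - a2) * ((1 - s) * a1 - c * (1 - s))).
        by ring.
      by rewrite cE; ring.
    by [].
  by rewrite !pmulr_rge0; lra.
have bc : b1 <= c.
  have : 0 <= (w2 - a2) * ((1 - s) * (c - b1)).
    have -> : (w2 - a2) * ((1 - s) * (c - b1)) =
      (b1 - w1) * (p2 - w2) - (a2 - w2) * (p1 - w1).
      have -> : p2 - w2 = - ((1 - s) * (w2 - a2)) by rewrite wp; ring.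
      transitivity ((w2 - a2) * (c * (1 - s) - (1 - s) * b1)); first by ring.
      by rewrite cE; ring.
    by [].
  by rewrite !pmulr_rge0; lra.
apply/segmentP; exists ((c - b1) / (a1 - b1)); split.
- by rewrite divr_ge0; lra.
- by rewrite ler_pdivrMr; lra.
- by rewrite /mix /=; congr pair; field; lra.
Qed.

(** The hypothesis on H says that both sides issuing from w keep H on their
    left. A point of the join above the chord satisfies the inequalities of the
    cap. A point below it lies on a segment from w to some q in H that crosses
    the line of the chord inside the cap, hence on the chord itself, so that the
    point lies between two points of H. *)
Lemma join_cap {R : realType} (H : set (R * R)) (a w b : R * R) :
  convex2 H -> H a -> H b -> a.2 = b.2 -> a.2 < w.2 -> b.1 < a.1 ->
  (forall q, H q -> [/\ q.2 <= a.2, 0 <= orient a w q & 0 <= orient w b q]) ->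
  join w H = H `|` cap a w b.
Proof.
move=> cH Ha Hb ab aw ba HH; have cH' := (convex2P H).1 cH.
have segH q : segment a b q -> H q.
  by move=> /segmentP[s [s0 s1 ->]]; exact: cH'.
apply/seteqP; split; last first.
  move=> p [Hp|/(cap_sub_join a w b p ab aw ba) [s [q [s0 s1 /segH Hq ->]]]].
    exists 0, p; split => //.
    by rewrite /mix; case: p {Hp} => p1 p2 /=; congr pair; ring.
  by exists s, q.
move=> _ [s [q [s0 s1 Hq ->]]]; have [qa q1 q2] := HH q Hq.
have [ap|pa] := leP a.2 (mix s w q).2.
  by right; split => //;
    rewrite orient_mix ?orient_endr ?orient_endl mulr0 add0r;
    apply: mulr_ge0 => //; rewrite subr_ge0.
left; move: pa; rewrite /mix /= => pa.
have wq : 0 < w.2 - q.2 by lra.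
(* The segment from q to w crosses the chord at weight k. *)
pose k := (a.2 - q.2) / (w.2 - q.2).
have kE : k * (w.2 - q.2) = a.2 - q.2 by rewrite divfK //; lra.
have k1 : k < 1 by rewrite ltr_pdivrMr; lra.
have sk : s < k by rewrite ltr_pdivlMr; lra.
have k0 : 0 < k by lra.
have cab : segment a b (mix k w q).
  have c2 : (mix k w q).2 = a.2 by rewrite /mix /=; lra.
  have o1 : 0 <= orient a w (mix k w q).
    rewrite orient_mix orient_endr mulr0 add0r.
    by apply: mulr_ge0 => //; rewrite subr_ge0 ltW.
  have o2 : 0 <= orient w b (mix k w q).
    rewrite orient_mix orient_endl mulr0 add0r.
    by apply: mulr_ge0 => //; rewrite subr_ge0 ltW.
  move: c2 o1 o2; case: (mix k w q) => c1 c2 /= ->.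
  rewrite /orient /= -ab => o1 o2.
  have ca : 0 <= (w.2 - a.2) * (a.1 - c1) by lra.
  have bc : 0 <= (w.2 - a.2) * (c1 - b.1) by lra.
  rewrite !pmulr_rge0 in ca bc; try lra.
  apply/segmentP; exists ((c1 - b.1) / (a.1 - b.1)); split.
  - by rewrite divr_ge0; lra.
  - by rewrite ler_pdivrMr; lra.
  - by rewrite /mix /= -ab; congr pair; field; lra.
have -> : (s * w.1 + (1 - s) * q.1, s * w.2 + (1 - s) * q.2) =
    mix (s / k) (mix k w q) q.
  by rewrite /mix /=; congr pair; field; lra.
apply: cH' => //; last exact: segH.
  by rewrite divr_ge0 //; lra.
by rewrite ler_pdivrMr //; lra.
Qed.

(** * Polygons of the class and their slides *)

Lemma class_P_x31 {R : realType} {m : nat} {v : nat -> R * R} :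
  class_P m v -> (v 3%N).1 < (v 1%N).1.
Proof.
move=> hP; have m3 := class_P_size hP.
have /andP[x32 x21] := class_P_x hP.
rewrite lt_neqAle (le_trans x32 x21) andbT; apply/eqP => x31.
suff : 3%N = 1%N by [].
apply: (class_P_inj hP); rewrite ?inE /idx /= ?(ltnW m3) //.
  by rewrite (leq_trans _ m3).
rewrite (surjective_pairing (v 3%N)) (surjective_pairing (v 1%N)) x31.
by rewrite (class_P_y13 hP).
Qed.

Lemma vertex_in_polygon {R : realType} (m : nat) (v : nat -> R * R) i :
  (1 <= i <= m)%N -> polygon m v (v i).
Proof. by move=> im; apply: sub_co; exists i. Qed.

Lemma orient_initial_sides {R : realType} {m : nat} {v : nat -> R * R} {i} :
  class_P m v -> (1 <= i <= m)%N ->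
  0 <= orient (v 1%N) (v 2%N) (v i) /\ 0 <= orient (v 2%N) (v 3%N) (v i).
Proof.
move=> hP im; have m3 := class_P_size hP.
have Pi := vertex_in_polygon m v i im; split.
  have := class_P_ccw hP (i := 1%N) _ Pi.
  rewrite modn_small ?(ltn_trans _ m3) //; apply.
  by rewrite /idx /= (ltn_trans _ m3).
have := class_P_ccw hP (i := 2%N) _ Pi.
rewrite modn_small ?(ltn_trans _ m3) //; apply.
by rewrite /idx /= (ltn_trans _ m3).
Qed.

(** A vertex strictly above the chord would lie, by the two sides at v 2, in
    the triangle v 1, v 2, v 3, and so on a segment from v 2 to a point of the
    chord. It would be an inner point of that segment, which an extreme point
    cannot be. *)
Lemma class_P_below {R : realType} {m : nat} {v : nat -> R * R} {i} :
  class_P m v -> (1 <= i <= m)%N -> i != 2%N -> (v i).2 <= (v 1%N).2.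
Proof.
move=> hP im i2; have m3 := class_P_size hP.
have y13 := class_P_y13 hP; have y32 := class_P_y32 hP.
have x31 := class_P_x31 hP.
have Pi := vertex_in_polygon m v i im.
have idx2 : (1 <= 2 <= m)%N by rewrite (ltn_trans _ m3).
rewrite leNgt; apply/negP => yi.
have capi : cap (v 1%N) (v 2%N) (v 3%N) (v i).
  by have [? ?] := orient_initial_sides hP im; split => //; exact: ltW.
have [s [c [s0 s1 /segmentP[r [r0 r1 cE]] viE]]] :
    join (v 2%N) (segment (v 1%N) (v 3%N)) (v i).
  by apply: cap_sub_join => //; rewrite y13.
have Pc : polygon m v c.
  have /convex2P cP := @convex_co R [set v i | i in idx m].
  by rewrite cE; apply: cP => //; apply: vertex_in_polygon;
    rewrite /= ?(ltn_trans _ m3).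
have c2 : c.2 = (v 1%N).2 by rewrite cE /mix /= -y13; ring.
have sgt0 : 0 < s.
  rewrite lt_neqAle s0 andbT; apply/eqP => s_0.
  by move: yi; rewrite viE -s_0 /mix /= c2; lra.
have slt1 : s < 1.
  rewrite lt_neqAle s1 andbT; apply/eqP => s_1.
  move/eqP : i2; apply; apply: (class_P_inj hP); rewrite ?inE //.
  rewrite viE s_1 /mix; case: (v 2%N) => w1 w2 /=; congr pair; ring.
have [t tE mixt] := mix_conv2 s (v 2%N) c s0 s1.
have : extreme_points (polygon m v) (v i).
  by rewrite (class_P_extreme hP); exists i.
move=> [_ /(_ (v 2%N) c t)] []; rewrite ?tE ?sgt0 //.
- exact: vertex_in_polygon.
- by rewrite -mixt.
- move=> v2i _; move/eqP : i2; apply; apply: (class_P_inj hP); rewrite ?inE //.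
Qed.

Lemma hat_below {R : realType} {m : nat} {v : nat -> R * R} {q} :
  class_P m v -> polygon_hat m v q -> q.2 <= (v 1%N).2.
Proof.
move=> hP Hq; apply: (smallest_sub (convex_below (v 1%N).2) _ Hq).
by move=> _ [i [im /eqP i2] <-]; exact: (class_P_below hP im i2).
Qed.

Lemma slide_join {R : realType} (m : nat) (v : nat -> R * R) (t : R) :
  (3 < m)%N ->
  mahler_slide m v t = join (t, (v 2%N).2) (polygon_hat m v).
Proof.
move=> m3; rewrite -co_setU1; last first.
  exists (v 1%N), 1%N => //; split => //.
  by rewrite /idx /= (ltn_trans _ m3).
rewrite /mahler_slide /polygon; congr co.
apply/seteqP; split => [_ [i im <-]|_ [->|[i [im i2] <-]]] /=.
- by case: eqVneq => [_|/eqP i2]; [left|right; exists i].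
- by exists 2%N; rewrite // /idx /= (ltn_trans _ m3).
- by exists i => //=; case: eqVneq.
Qed.

Lemma compact_slide {R : realType} (m : nat) (v : nat -> R * R) (t : R) :
  compact (mahler_slide m v t).
Proof.
apply: compact_co_finite; apply: finite_image.
by apply: sub_finite_set (finite_II m.+1) => i /= /andP[_].
Qed.

(** The polygon is the join of the slid apex with polygon_hat, to which
    join_cap applies once the apex keeps every other vertex on the left of its
    two sides. *)
Lemma slideE {R : realType} (m : nat) (v : nat -> R * R) (t : R) :
  class_P m v ->
  (forall i, (1 <= i <= m)%N -> i != 2%N ->
    0 <= orient (v 1%N) (t, (v 2%N).2) (v i) /\
    0 <= orient (t, (v 2%N).2) (v 3%N) (v i)) ->
  mahler_slide m v t =
  polygon_hat m v `|` cap (v 1%N) (t, (v 2%N).2) (v 3%N).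
Proof.
move=> hP orientP; have m3 := class_P_size hP.
rewrite slide_join //; apply: join_cap.
- exact: convex_co.
- apply: sub_co; exists 1%N => //; split => //.
  by rewrite /idx /= (ltn_trans _ m3).
- apply: sub_co; exists 3%N => //; split => //.
  by rewrite /idx /= (ltn_trans _ m3).
- exact: (class_P_y13 hP).
- by rewrite /= (class_P_y13 hP) (class_P_y32 hP).
- exact: class_P_x31 hP.
move=> q Hq; split.
- exact: hat_below Hq.
- apply: (smallest_sub (convex_orient _ _) _ Hq).
  by move=> _ [i [im /eqP i2] <-]; have [] := orientP i im i2.
- apply: (smallest_sub (convex_orient _ _) _ Hq).
  by move=> _ [i [im /eqP i2] <-]; have [] := orientP i im i2.
Qed.

(** At t = xir the right side of the cap is the prolongation of the side from
    v m to v 1, so it keeps the polygon on its left; moving t to the left only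
    helps for points below the chord. The left side is symmetric, with xil and
    the side from v 3 to v 4. *)
Lemma orient_slid_sides {R : realType} {m : nat} {v : nat -> R * R}
    {xil xir t : R} {i} :
  class_P m v ->
  segment (xil, (v 2%N).2) (v 4%N) (v 3%N) ->
  segment (xir, (v 2%N).2) (v m) (v 1%N) ->
  xil <= t <= xir -> (1 <= i <= m)%N -> i != 2%N ->
  0 <= orient (v 1%N) (t, (v 2%N).2) (v i) /\
  0 <= orient (t, (v 2%N).2) (v 3%N) (v i).
Proof.
move=> hP /segmentP[s [s0 s1 sE]] /segmentP[r [r0 r1 rE]] /andP[lt tr] im i2.
have m3 := class_P_size hP.
have y13 := class_P_y13 hP; have y32 := class_P_y32 hP.
have below := class_P_below hP im i2.
have Pi := vertex_in_polygon m v i im.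
have oL : 0 <= orient (v 3%N) (v 4%N) (v i).
  have := class_P_ccw hP (i := 3%N) _ Pi.
  by rewrite modn_small //; apply; rewrite /idx /= (ltn_trans _ m3).
have oR : 0 <= orient (v m) (v 1%N) (v i).
  have := class_P_ccw hP (i := m) _ Pi.
  by rewrite modnn; apply; rewrite /idx /= leqnn (ltn_trans _ m3).
have sgt0 : 0 < s.
  rewrite lt_neqAle s0 andbT; apply/eqP => s_0; suff : 3%N = 4%N by [].
  apply: (class_P_inj hP); rewrite ?inE /idx /= ?m3 ?(ltnW m3) //.
  by rewrite sE -s_0 /mix; case: (v 4%N) => w1 w2 /=; congr pair; ring.
have rgt0 : 0 < r.
  rewrite lt_neqAle r0 andbT; apply/eqP => r_0; suff : 1%N = m.
    by move=> E; move: m3; rewrite -E.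
  apply: (class_P_inj hP); rewrite ?inE /idx /= ?leqnn ?(ltn_trans _ m3) //.
  by rewrite rE -r_0 /mix; case: (v m) => w1 w2 /=; congr pair; ring.
have s1' : 0 <= 1 - s by lra.
have r1' : 0 <= 1 - r by lra.
move: y13 y32 below oL oR sE rE.
case: (v 1%N) (v 2%N) (v 3%N) (v 4%N) (v m) (v i)
  => [a1 a2] [w1 w2] [b1 b2] [d1 d2] [e1 e2] [q1 q2].
rewrite /orient /mix /= => <- aw qa oL oR [b1E b2E] [a1E a2E].
split.
(* The two orientations are proportional because v m, v 1 and the apex are
   collinear. *)
- have key : 0 <= r * ((xir - a1) * (q2 - a2) - (w2 - a2) * (q1 - a1)).
    have -> : r * ((xir - a1) * (q2 - a2) - (w2 - a2) * (q1 - a1)) =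
      (1 - r) * ((a1 - e1) * (q2 - e2) - (a2 - e2) * (q1 - e1)).
      by rewrite a1E a2E; ring.
    exact: mulr_ge0.
  rewrite pmulr_rge0 // in key; nra.
- have key : 0 <= s * ((b1 - xil) * (q2 - w2) - (a2 - w2) * (q1 - xil)).
    have -> : s * ((b1 - xil) * (q2 - w2) - (a2 - w2) * (q1 - xil)) =
      (1 - s) * ((d1 - b1) * (q2 - a2) - (d2 - a2) * (q1 - b1)).
      by rewrite b1E b2E; ring.
    exact: mulr_ge0.
  rewrite pmulr_rge0 // in key; nra.
Qed.

(** * Sliding is a shear *)

Definition ramp {R : realType} (y1 y2 y : R) : R :=
  Num.max 0 (y - y1) / (y2 - y1).

Lemma continuous_ramp {R : realType} (y1 y2 : R) : continuous (ramp y1 y2).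
Proof.
move=> y; apply: cvgM; last exact: cvg_cst.
apply: (@continuous_max _ _ (fun=> 0) (fun y => y - y1)); first exact: cvg_cst.
by apply: cvgB; [exact: cvg_id|exact: cvg_cst].
Qed.

(** On and above the chord, the shear with parameter s is the affine map that
    fixes the line of the chord and sends the apex (u, y2) to (u + s, y2). *)
Lemma shear_cap {R : realType} (a b : R * R) (y2 u s : R) (p : R * R) :
  a.2 = b.2 -> a.2 < y2 ->
  cap a (u + s, y2) b (shear (ramp a.2 y2) s p) <-> cap a (u, y2) b p.
Proof.
case: a b p => [a1 a2] [b1 b2] [p1 p2] /= <- ay; rewrite /cap /shear /orient /=.
have ya0 : y2 - a2 != 0 by lra.
have H : a2 <= p2 -> (y2 - a2) * ramp a2 y2 p2 = p2 - a2.
  by move=> ap; rewrite /ramp max_r ?subr_ge0 // mulrC divfK.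
split=> -[ap h1 h2]; split=> //; move: (H ap) h1 h2;
  set g := ramp _ _ _ => gE h1 h2;
  (have E : s * (p2 - a2) = (y2 - a2) * (s * g) by rewrite -gE; ring); lra.
Qed.

Lemma shear_below {R : realType} (H : set (R * R)) (y1 y2 s : R) (p : R * R) :
  (forall q, H q -> q.2 <= y1) -> H (shear (ramp y1 y2) s p) <-> H p.
Proof.
move=> HH.
have E : p.2 <= y1 -> shear (ramp y1 y2) s p = p.
  move=> py; rewrite /shear /ramp max_l ?subr_le0 // mul0r mulr0 addr0.
  by case: p {py}.
split=> [Hp|Hp]; first by rewrite -E //; exact: HH Hp.
by rewrite E //; exact: HH.
Qed.

(** The centroid of the triangle satisfies its inequalities strictly. *)
Lemma interior_cap {R : realType} (a w b : R * R) :
  a.2 = b.2 -> a.2 < w.2 -> b.1 < a.1 ->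
  exists2 p, interior (cap a w b) p & a.2 < p.2.
Proof.
move=> ab aw ba.
pose p : R * R := ((a.1 + b.1 + w.1) / 3, (a.2 + a.2 + w.2) / 3).
have p2 : a.2 < p.2 by rewrite /p /=; lra.
exists p => //.
have near_pos (f : R * R -> R) : planar_continuous f -> 0 < f p ->
    \forall q \near p, 0 <= f q.
  move=> cf fp; apply: (cf p [set y | 0 <= y]).
  by near=> y; apply: ltW; near: y; exact: lt_nbhsr.
have n1 : \forall q \near p, 0 <= q.2 + - a.2.
  apply: (near_pos (fun q => q.2 + - a.2)); last by rewrite subr_gt0.
  planar_continuity.
have n2 : \forall q \near p,
    0 <= (w.1 - a.1) * (q.2 + - a.2) + - (w.2 - a.2) * (q.1 + - a.1).
  apply: (near_pos (fun q => (w.1 - a.1) * (q.2 + - a.2)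
    + - (w.2 - a.2) * (q.1 + - a.1))).
    planar_continuity.
  rewrite /p /=; set t := (X in 0 < X).
  have -> : t = (w.2 - a.2) * (a.1 - b.1) / 3 by rewrite /t; field.
  by rewrite divr_gt0 // mulr_gt0 // subr_gt0.
have n3 : \forall q \near p,
    0 <= (b.1 - w.1) * (q.2 + - w.2) + - (b.2 - w.2) * (q.1 + - w.1).
  apply: (near_pos (fun q => (b.1 - w.1) * (q.2 + - w.2)
    + - (b.2 - w.2) * (q.1 + - w.1))).
    planar_continuity.
  rewrite /p /=; set t := (X in 0 < X).
  have -> : t = (w.2 - a.2) * (a.1 - b.1) / 3 by rewrite /t -ab; field.
  by rewrite divr_gt0 // mulr_gt0 // subr_gt0.
apply: filterS (filterI n1 (filterI n2 n3)) => q [h1 [h2 h3]]; split.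
- by rewrite -subr_ge0.
- by move: h2; rewrite /orient mulNr.
- by move: h3; rewrite /orient mulNr.
Unshelve. all: by end_near.
Qed.

Lemma interior_below0 {R : realType} (H : set (R * R)) :
  interior H (0, 0) ->
  exists2 y, y < 0 & interior H (0, y) /\ interior H (0, y / 2).
Proof.
move=> /nbhs_interior /nbhs_ballP [r /= r0 rH].
exists (- (r / 2)); first lra.
split; apply: rH; split; rewrite /ball /= !sub0r ?opprK ?oppr0 ?normr0 //.
  by rewrite gtr0_norm; lra.
by rewrite mulNr opprK gtr0_norm; lra.
Qed.

(** Below the chord the function is the affine function b * y + c, which cannot
    vanish at two heights unless b = c = 0; then a is nonzero, and the function
    is nonzero at every point strictly above the chord. *)
Lemma ramp_nondegenerate {R : realType} (m : nat) (v : nat -> R * R)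
    (t a b c : R) :
  class_P m v ->
  mahler_slide m v t =
    polygon_hat m v `|` cap (v 1%N) (t, (v 2%N).2) (v 3%N) ->
  [|| a != 0, b != 0 | c != 0] ->
  exists2 p, interior (mahler_slide m v t) p &
    a * ramp (v 1%N).2 (v 2%N).2 p.2 + b * p.2 + c != 0.
Proof.
move=> hP ->; have y13 := class_P_y13 hP; have y32 := class_P_y32 hP.
have y1 := class_P_y1 hP; have x31 := class_P_x31 hP.
have ramp0 y : y < 0 -> ramp (v 1%N).2 (v 2%N).2 y = 0.
  by move=> y0; rewrite /ramp max_l ?mul0r //; lra.
have [y yl0 [iy iy2]] := interior_below0 _ (class_P_int hP).
have Hsub := @subsetUl _ (polygon_hat m v) (cap (v 1%N) (t, (v 2%N).2) (v 3%N)).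
have csub := @subsetUr _ (polygon_hat m v) (cap (v 1%N) (t, (v 2%N).2) (v 3%N)).
have [E1|N1] := eqVneq (b * y + c) 0; last first.
  exists (0, y); first exact: (interiorS Hsub).
  by rewrite /= ramp0 // mulr0 add0r.
have [E2|N2] := eqVneq (b * (y / 2) + c) 0; last first.
  exists (0, y / 2); first exact: (interiorS Hsub).
  by rewrite /= ramp0 ?mulr0 ?add0r //; lra.
have c0 : c = 0 by lra.
have b0 : b = 0.
  have /eqP : b * y = 0 by lra.
  by rewrite mulf_eq0 => /orP[/eqP //|/eqP]; lra.
rewrite c0 b0 !eqxx /= orbF => a0.
have [|||p ip ap] := interior_cap (v 1%N) (t, (v 2%N).2) (v 3%N) => //=.
  by rewrite y13.
exists p; first exact: (interiorS csub).
rewrite mul0r !addr0 mulf_neq0 //.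
rewrite /ramp max_r; last by lra.
by rewrite gt_eqF // divr_gt0 //; lra.
Qed.

Lemma preimage_slide {R : realType} (m : nat) (v : nat -> R * R) (u t : R) :
  class_P m v ->
  mahler_slide m v u =
    polygon_hat m v `|` cap (v 1%N) (u, (v 2%N).2) (v 3%N) ->
  mahler_slide m v t =
    polygon_hat m v `|` cap (v 1%N) (t, (v 2%N).2) (v 3%N) ->
  shear (ramp (v 1%N).2 (v 2%N).2) (t - u) @^-1` mahler_slide m v t =
  mahler_slide m v u.
Proof.
move=> hP -> ->; have y13 := class_P_y13 hP; have y32 := class_P_y32 hP.
have tE : t = u + (t - u) by ring.
rewrite {2}tE; move: (t - u) => s.
have y12 : (v 1%N).2 < (v 2%N).2 by rewrite y13.
apply/seteqP; split=> p /=.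
  case=> [/shear_below Hp|/shear_cap cp]; [left|right].
    by apply: Hp => q; exact: hat_below.
  exact: cp.
case=> [Hp|cp]; [left|right].
  by apply/shear_below => // q; exact: hat_below.
exact/shear_cap.
Qed.

Theorem lemma6p3 (R : realType) (m : nat) (v : nat -> R * R) (xil xir : R)
    (hP : class_P m v)
    (hl : segment (xil, (v 2%N).2) (v 4%N) (v 3%N))
    (hr : segment (xir, (v 2%N).2) (v m) (v 1%N)) :
  let f : R -> R := fun t => (calC (mahler_slide m v t))^-1 in
  @convex_function R R^o `[xil, xir] f /\
  exists2 p : {poly R}, size p = 3%N &
    forall t : R, t \in `[xil, xir] -> f t = p.[t].
Proof.
move=> f; pose u := (v 2%N).1.
(* The reference position is the given polygon: there the sides at the apex are
   sides of the polygon, so u need not be located in [xil, xir]. *)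
have splitu : mahler_slide m v u =
    polygon_hat m v `|` cap (v 1%N) (u, (v 2%N).2) (v 3%N).
  apply: slideE => // i im _; rewrite /u -surjective_pairing.
  exact: (orient_initial_sides hP im).
have splitt t : t \in `[xil, xir] -> mahler_slide m v t =
    polygon_hat m v `|` cap (v 1%N) (t, (v 2%N).2) (v 3%N).
  rewrite in_itv /= => tx; apply: slideE => // i im i2.
  exact: (orient_slid_sides hP hl hr tx im i2).
pose g := ramp (v 1%N).2 (v 2%N).2.
have [|[[al be] ga] [/= al0 calCE]] := inv_calC_shear _ g
    (compact_slide m v u) (continuous_ramp _ _).
  by move=> a b c; exact: ramp_nondegenerate.
have fE t : t \in `[xil, xir] -> f t = al * (t - u) ^+ 2 + be * (t - u) + ga.
  move=> tx; apply: calCE; first exact: compact_slide.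
  by apply: preimage_slide => //; exact: splitt.
split.
  move=> s x y xI yI.
  have {}xI : (x : R) \in `[xil, xir] by move: xI; rewrite inE.
  have {}yI : (y : R) \in `[xil, xir] by move: yI; rewrite inE.
  have s0 : 0 <= s%:num by [].
  have s1 : s%:num <= 1 by [].
  have zI : s%:num * x + (1 - s%:num) * y \in `[xil, xir].
    move: xI yI; rewrite !in_itv /= => /andP[? ?] /andP[? ?].
    by apply/andP; split; nra.
  rewrite [leLHS](fE _ zI).
  rewrite [leRHS](_ : _ = s%:num * f x + (1 - s%:num) * f y) //.
  rewrite !fE // -subr_ge0; set d := (X in 0 <= X).
  have -> : d = al * (s%:num * (1 - s%:num) * (x - y) ^+ 2) by rewrite /d; ring.
  apply: mulr_ge0; first exact: ltW.
  apply: mulr_ge0; last exact: sqr_ge0.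
  by apply: mulr_ge0 => //; rewrite subr_ge0.
pose p : {poly R} := al *: ('X - u%:P) ^+ 2 + (be *: ('X - u%:P) + ga%:P).
exists p; last first.
  move=> t /fE ->.
  by rewrite /p !(hornerXsubC, hornerD, hornerZ, horner_exp, hornerC) addrA.
rewrite /p size_polyDl size_scale ?gt_eqF // size_exp_XsubC //.
rewrite (leq_ltn_trans (size_polyD _ _)) // gtn_max.
rewrite (leq_ltn_trans (size_scale_leq _ _)) ?size_XsubC //=.
by rewrite (leq_ltn_trans (size_polyC_leq1 _)).
Qed.
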